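(* Let $\alpha\ge0$, let $\theta\in\Theta$ be an escort parameter and let $\theta_0\in\Theta$. Under the standing assumptions listed in the context, the influence functions of the power subdivergence estimators $\tilde\theta_{\alpha,\theta,n}=\tilde T_{\alpha,\theta}(P_n)$ at $P_{\theta_0}$ are given by $$\mathrm{IF}(x;\tilde T_{\alpha,\theta},\theta_0)=\boldsymbol I_{\alpha,\theta}(\theta_0)^{-1}\left[\left(\frac{p_\theta(x)}{p_{\theta_0}(x)}\right)^{\alpha}s_{\theta_0}(x)-P_{\theta_0}\cdot\left(\frac{p_\theta}{p_{\theta_0}}\right)^{\alpha}s_{\theta_0}\right]\quad\text{if }\alpha>0,$$ $$\mathrm{IF}(x;\tilde T_{0,\theta},\theta_0)=\boldsymbol I(\theta_0)^{-1}s_{\theta_0}(x)\quad\text{if }\alpha=0,$$ where $$\boldsymbol I_{\alpha,\theta}(\theta_0)=P_{\theta_0}\cdot\left(\frac{p_\theta}{p_{\theta_0}}\right)^{\alpha}s_{\theta_0}^{\rm t}s_{\theta_0}\ \ (\alpha>0),\qquad \boldsymbol I(\theta_0)=P_{\theta_0}\cdot s_{\theta_0}^{\rm t}s_{\theta_0}\ \ (\alpha=0).$$ If the escort parameter $\theta$ coincides with the true parameter $\theta_0$, then $\mathrm{IF}(x;\tilde T_{\alpha,\theta_0},\theta_0)=\boldsymbol I(\theta_0)^{-1}s_{\theta_0}(x)$ for all $\alpha\ge0$.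
   Context: Model: $(\mathcal X,\mathcal A)$ is a measurable space, $\Theta\subset\mathbb R^d$, and $\mathcal P=\{P_\theta:\theta\in\Theta\}$ is a family of nonatomic probability measures with densities $p_\theta=\mathrm dP_\theta/\mathrm d\lambda$ with respect to a $\sigma$-finite $\lambda$, identifiable ($P_\theta\ne P_{\tilde\theta}$ if $\theta\ne\tilde\theta$) and measure-theoretically equivalent (products of densities $>0$ $\lambda$-a.s.). $P_0\notin\mathcal P$ is a probability measure equivalent with the members of $\mathcal P$; $\mathcal P^+=\mathcal P\cup\{P_0\}$; $\mathcal P_{\rm emp}$ is the set of empirical measures $P_n=\frac1n\sum_{i=1}^n\delta_{X_i}$; $\mathcal Q=\mathcal P^+\cup\mathcal P_{\rm emp}$. Write $Q\cdot f=\int f\,\mathrm dQ$. Let $Q_{\varepsilon,x}=(1-\varepsilon)Q+\varepsilon\delta_x$ for $x\in\mathcal X$, $Q\in\mathcal Q$, $0\le\varepsilon\le1$, and let $C(\mathcal Q)$ be the set of all these mixtures. Power functions: $\phi_\alpha(t)=\frac{t^\alpha-\alpha t+\alpha-1}{\alpha(\alpha-1)}$ if $\alpha(\alpha-1)\ne0$, $\phi_0(t)=-\ln t+t-1$, $\phi_1(t)=t\ln t-t+1$. It is assumed that with $\phi=\phi_\alpha$ and $\phi^{\#}(t)=\phi(t)-t\phi'(t)$ the functions $\phi(p_\theta/p_{\tilde\theta})$, $\phi'(p_\theta/p_{\tilde\theta})$, $\phi^{\#}(p_\theta/p_{\tilde\theta})$ are $Q$-integrable for all $\theta,\tilde\theta\in\Theta$,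 $Q\in\mathcal Q$. For $\alpha>0$ let $$M_{\alpha,\theta}(Q,\tilde\theta)=\begin{cases}\frac1{1-\alpha}P_{\tilde\theta}\cdot\left(\frac{p_\theta}{p_{\tilde\theta}}\right)^\alpha+\frac1\alpha Q\cdot\left(\frac{p_\theta}{p_{\tilde\theta}}\right)^\alpha&\alpha\ne1,\\ P_\theta\cdot\ln\frac{p_{\tilde\theta}}{p_\theta}+Q\cdot\frac{p_\theta}{p_{\tilde\theta}}&\alpha=1,\end{cases}$$ and $\tilde T_{\alpha,\theta}(Q)=\mathrm{argmin}_{\tilde\theta}M_{\alpha,\theta}(Q,\tilde\theta)$. For $\alpha=0$, $\tilde T_{0,\theta}(Q)=\mathrm{argmax}_{\tilde\theta}\,Q\cdot\ln p_{\tilde\theta}$ (the maximum likelihood estimator, for every escort $\theta$). The power subdivergence estimator is $\tilde\theta_{\alpha,\theta,n}=\tilde T_{\alpha,\theta}(P_n)$. Smoothness assumptions: $p_\theta$ is twice differentiable in $\theta$; $s_\theta=\frac{\mathrm d}{\mathrm d\theta}\ln p_\theta$; $M_{\alpha,\theta}(Q,\tilde\theta)$ is twice differentiable in $\tilde\theta$ with differentiation and integration interchangeable; the argminima $\tilde T_{\alpha,\theta}(Q)$ exist and solve in $\tilde\theta$ the equation $$\Psi_{\alpha,\theta}(Q,\tilde\theta)=\frac{\mathrm d}{\mathrm d\tilde\theta}M_{\alpha,\theta}(Q,\tilde\theta)=P_{\tilde\theta}\cdot\left(\frac{p_\theta}{p_{\tilde\theta}}\right)^\alpha s_{\tilde\theta}-Q\cdot\left(\frac{p_\theta}{p_{\tilde\theta}}\right)^\alpha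 s_{\tilde\theta}=0$$ (for $\alpha=0$ this is $Q\cdot s_{\tilde\theta}=0$, where the analogous regularity is assumed). Influence function: $\mathrm{IF}(x;T,Q)=\lim_{\varepsilon\downarrow0}\varepsilon^{-1}\left(T(Q_{\varepsilon,x})-T(Q)\right)$, assumed to exist for all $x\in\mathcal X$; $\mathrm{IF}(x;T,\theta_0)=\mathrm{IF}(x;T,P_{\theta_0})$. Matrices whose inverse appears are assumed invertible. $s^{\rm t}s$ denotes the $d\times d$ matrix with entries $s_is_j$; in the formulas for IF the score is read as a column vector. *)

(* Defs.v *)
From HB Require Import structures.
From mathcomp Require Import all_boot all_order all_algebra.
From mathcomp Require Import all_classical all_reals all_analysis.

Set Implicit Arguments.
Unset Strict Implicit.
Unset Printing Implicit Defensive.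

Import Order.TTheory GRing.Theory Num.Theory.
Import numFieldNormedType.Exports.

Local Open Scope classical_set_scope.
Local Open Scope ring_scope.

Section Contamination.
Context {disp : measure_display} {X : measurableType disp} {R : realType}.

(* The weight e is clamped to [0, 1] so that [contaminate Q x e] is a
   probability measure for every real e; on [0, 1] it is
   (1 - e) Q + e delta_x. *)
Definition clamp01 (e : R) : R := Num.max 0 (Num.min e 1).

Lemma clamp01_ge0 (e : R) : 0 <= clamp01 e.
Proof. by rewrite /clamp01 le_max lexx. Qed.

Lemma onem_clamp01_ge0 (e : R) : 0 <= 1 - clamp01 e.
Proof. by rewrite subr_ge0 /clamp01 ge_max ler01 ge_min lexx orbT. Qed.

Lemma clamp01_id (e : R) : 0 <= e -> e <= 1 -> clamp01 e = e.
Proof. by move=> e0 e1; rewrite /clamp01 (min_idPl e1) (max_idPr e0). Qed.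

Definition contaminate (Q : probability X R) (x : X) (e : R) : set X -> \bar R :=
  measure_add (mscale (NngNum (onem_clamp01_ge0 e)) Q)
              (mscale (NngNum (clamp01_ge0 e)) \d_x).

HB.instance Definition _ (Q : probability X R) (x : X) (e : R) :=
  Measure.copy (contaminate Q x e)
    (measure_add (mscale (NngNum (onem_clamp01_ge0 e)) Q)
                 (mscale (NngNum (clamp01_ge0 e)) \d_x)).

Lemma contaminate_setT (Q : probability X R) (x : X) (e : R) :
  contaminate Q x e setT = 1%E.
Proof.
rewrite /contaminate measure_addE; transitivity
  ((1 - clamp01 e)%:E * Q setT + (clamp01 e)%:E * \d_x setT)%E => //.
by rewrite [Q setT]probability_setT diracT !mule1 -EFinD subrK.
Qed.

HB.instance Definition _ (Q : probability X R) (x : X) (e : R) :=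
  Measure_isProbability.Build _ _ _ (contaminate Q x e) (contaminate_setT Q x e).

Lemma contaminateE (Q : probability X R) (x : X) (e : R) (A : set X) :
  0 <= e -> e <= 1 ->
  contaminate Q x e A = ((1 - e)%:E * Q A + e%:E * \d_x A)%E.
Proof.
move=> e0 e1; rewrite /contaminate measure_addE.
transitivity ((1 - clamp01 e)%:E * Q A + (clamp01 e)%:E * \d_x A)%E => //.
by rewrite clamp01_id.
Qed.

Definition nonatomic (mu : {measure set X -> \bar R}) : Prop :=
  forall A, measurable A -> (0 < mu A)%E ->
    exists B, [/\ measurable B, B `<=` A, (0 < mu B)%E & (mu B < mu A)%E].

Definition empirical_measures : set (probability X R) :=
  [set Q | exists (n : nat) (xs : 'I_n.+1 -> X), forall A, measurable A ->
     Q A = ((n.+1%:R^-1)%:E * \sum_(i < n.+1) \d_(xs i) A)%E].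

Definition mixtures (calQ : set (probability X R)) : set (probability X R) :=
  [set Q' | exists Q x e, [/\ calQ Q, 0 <= e, e <= 1 &
     forall A, measurable A -> Q' A = ((1 - e)%:E * Q A + e%:E * \d_x A)%E]].

Definition IF {d : nat} (x : X) (T : probability X R -> 'cV[R]_d)
    (Q : probability X R) : 'cV[R]_d :=
  lim (e^-1 *: (T (contaminate Q x e) - T Q) @[e --> 0^'+]).

Definition has_IF {d : nat} (x : X) (T : probability X R -> 'cV[R]_d)
    (Q : probability X R) : Prop :=
  cvg (e^-1 *: (T (contaminate Q x e) - T Q) @[e --> 0^'+]).

End Contamination.

Section Calculus.
Context {R : realType} {d : nat}.

Definition partial (i : 'I_d) (f : 'cV[R]_d -> R) (t : 'cV[R]_d) : R :=
  'D_(delta_mx i 0) f t.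

Definition twice_differentiable (f : 'cV[R]_d -> R) (t : 'cV[R]_d) : Prop :=
  (\forall u \near t, differentiable f u) /\
  forall i, differentiable (partial i f) t.

Context {disp : measure_display} {X : measurableType disp}.

(* t |-> \int f t dmu is twice differentiable, and its first and second
   derivatives are obtained by differentiating the integrand. *)
Record interchangeable (mu : {measure set X -> \bar R})
    (f : 'cV[R]_d -> X -> R) (t : 'cV[R]_d) : Prop := Interchangeable {
  interchange_int : mu.-integrable setT (EFin \o f t);
  interchange_int1 : forall i,
    mu.-integrable setT (EFin \o (fun x => partial i (f^~ x) t));
  interchange_int2 : forall i j,
    mu.-integrable setT (EFin \o (fun x => partial j (partial i (f^~ x)) t));
  interchange_diff : twice_differentiable (fun u => \int[mu]_x f u x) t;
  interchange1 : forall i,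
    partial i (fun u => \int[mu]_x f u x) t =
    \int[mu]_x partial i (f^~ x) t;
  interchange2 : forall i j,
    partial j (partial i (fun u => \int[mu]_x f u x)) t =
    \int[mu]_x partial j (partial i (f^~ x)) t
}.

End Calculus.

Definition phi {R : realType} (a t : R) : R :=
  if a == 0 then - ln t + t - 1
  else if a == 1 then t * ln t - t + 1
  else (t `^ a - a * t + a - 1) / (a * (a - 1)).

Definition phi_sharp {R : realType} (a t : R) : R := phi a t - t * derive1 (phi a) t.

Section Model.
Context {R : realType} {d : nat}.
Context {disp : measure_display} {X : measurableType disp}.

Definition calQ (Theta : set 'cV[R]_d) (P : 'cV[R]_d -> probability X R)
    (P0 : probability X R) : set (probability X R) :=
  [set Q | [\/ exists2 t, Theta t & Q = P t, Q = P0 | empirical_measures Q]].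

(* [P] and [p] are total functions of the parameter; only their values on
   [Theta] matter. The parameter set is open because scores and estimating
   equations involve derivatives with respect to the parameter at each of its
   points. Equality of measures is tested on measurable sets only. *)
Record standard_model (lam : {sigma_finite_measure set X -> \bar R})
    (Theta : set 'cV[R]_d) (P : 'cV[R]_d -> probability X R)
    (p : 'cV[R]_d -> X -> R) (P0 : probability X R) : Prop := StandardModel {
  model_open : open Theta;
  model_nonatomic : forall t, Theta t -> nonatomic (P t);
  model_dens_meas : forall t, Theta t -> measurable_fun setT (p t);
  model_dens_ge0 : forall t x, Theta t -> 0 <= p t x;
  model_dens : forall t A, Theta t -> measurable A ->
    P t A = (\int[lam]_(x in A) (p t x)%:E)%E;
  model_ident : forall t u, Theta t -> Theta u ->
    (forall A, measurable A -> P t A = P u A) -> t = u;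
  model_equiv : forall t u, Theta t -> Theta u ->
    {ae lam, forall x, 0 < p t x * p u x};
  model_P0_notin : forall t, Theta t ->
    ~ (forall A, measurable A -> P0 A = P t A);
  model_P0_equiv : forall t, Theta t -> P0 `<< P t /\ P t `<< P0
}.

Definition phi_integrable (a : R) (Theta : set 'cV[R]_d)
    (P : 'cV[R]_d -> probability X R) (p : 'cV[R]_d -> X -> R)
    (P0 : probability X R) : Prop :=
  forall t u Q, Theta t -> Theta u -> calQ Theta P P0 Q ->
    [/\ Q.-integrable setT (EFin \o (fun x => phi a (p t x / p u x))),
        Q.-integrable setT (EFin \o (fun x => derive1 (phi a) (p t x / p u x))) &
        Q.-integrable setT (EFin \o (fun x => phi_sharp a (p t x / p u x)))].

Section Estimators.
Variables (P : 'cV[R]_d -> probability X R) (p : 'cV[R]_d -> X -> R).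

(* Meaningful at the points x where p t x > 0, where ln (p t x) is the true
   logarithm; these are lam-almost all points. *)
Definition score (t : 'cV[R]_d) (x : X) : 'cV[R]_d :=
  \col_i partial i (fun u => ln (p u x)) t.

Definition M (a : R) (th : 'cV[R]_d) (Q : probability X R) (t : 'cV[R]_d) : R :=
  if a == 1 then
    \int[P th]_x ln (p t x / p th x) + \int[Q]_x (p th x / p t x)
  else
    (1 - a)^-1 * \int[P t]_x (p th x / p t x) `^ a
    + a^-1 * \int[Q]_x (p th x / p t x) `^ a.

Definition loglik (Q : probability X R) (t : 'cV[R]_d) : R :=
  \int[Q]_x ln (p t x).

(* [T] is any selection from the argmin on [C]; uniqueness is not required.
   For a = 0 it is the maximum likelihood estimator, whatever the escort. *)
Definition subdivergence_estimator (a : R) (th : 'cV[R]_d)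
    (Theta : set 'cV[R]_d) (C : set (probability X R))
    (T : probability X R -> 'cV[R]_d) : Prop :=
  forall Q, C Q -> Theta (T Q) /\
    forall t, Theta t ->
      if a == 0 then loglik Q t <= loglik Q (T Q)
      else M a th Q (T Q) <= M a th Q t.

Definition Psi (a : R) (th : 'cV[R]_d) (Q : probability X R) (t : 'cV[R]_d) :
    'cV[R]_d :=
  if a == 0 then \col_i \int[Q]_x score t x i 0
  else \col_i (\int[P t]_x ((p th x / p t x) `^ a * score t x i 0)
               - \int[Q]_x ((p th x / p t x) `^ a * score t x i 0)).

(* Since P_t has density p_t, M_{a,th}(Q, t) is the sum of
   \int lam_integrand a th t dlam and \int Q_integrand a th t dQ for a > 0.
   For a = 0 the first integral is \int p_t dlam = 1, and differentiating it
   under the integral sign is the usual regularity of the score; the second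
   one is minus the mean log-likelihood. *)
Definition lam_integrand (a : R) (th t : 'cV[R]_d) (x : X) : R :=
  if a == 0 then p t x
  else if a == 1 then p th x * ln (p t x / p th x)
  else (1 - a)^-1 * (p t x * (p th x / p t x) `^ a).

Definition Q_integrand (a : R) (th t : 'cV[R]_d) (x : X) : R :=
  if a == 0 then - ln (p t x)
  else a^-1 * (p th x / p t x) `^ a.

Record smooth_model (a : R) (th : 'cV[R]_d)
    (lam : {sigma_finite_measure set X -> \bar R})
    (Theta : set 'cV[R]_d) (C : set (probability X R))
    (T : probability X R -> 'cV[R]_d) : Prop := SmoothModel {
  smooth_dens : forall t x, Theta t -> twice_differentiable (p^~ x) t;
  smooth_M : forall Q t, C Q -> Theta t ->
    twice_differentiable (if a == 0 then loglik Q else M a th Q) t;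
  smooth_lam : forall t, Theta t -> interchangeable lam (lam_integrand a th) t;
  smooth_Q : forall Q t, C Q -> Theta t ->
    interchangeable Q (Q_integrand a th) t;
  smooth_equation : forall Q, C Q -> Psi a th Q (T Q) = 0
}.

Definition escort_info (a : R) (th t : 'cV[R]_d) : 'M[R]_d :=
  \matrix_(i, j) \int[P t]_x
    ((p th x / p t x) `^ a * (score t x i 0 * score t x j 0)).

Definition fisher_info (t : 'cV[R]_d) : 'M[R]_d :=
  \matrix_(i, j) \int[P t]_x (score t x i 0 * score t x j 0).

Definition escort_score_mean (a : R) (th t : 'cV[R]_d) : 'cV[R]_d :=
  \col_i \int[P t]_x ((p th x / p t x) `^ a * score t x i 0).

End Estimators.

End Model.

(* Main.v *)
Require Import Defs.
From mathcomp Require Import all_boot all_order all_algebra.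
From mathcomp Require Import all_classical all_reals all_analysis.
From mathcomp Require Import measurable_realfun ring.

Set Implicit Arguments.
Unset Strict Implicit.
Unset Printing Implicit Defensive.

Import Order.TTheory GRing.Theory Num.Theory.
Import numFieldNormedType.Exports.

Local Open Scope classical_set_scope.
Local Open Scope ring_scope.

(** Write [r = (p_theta / p_t)^alpha] for the escort weight and [s] for the
    score at [t]. For every [alpha >= 0] the estimator minimizes over [t] a
    criterion [Lam t + K Q t], where [Lam t] is an integral over the dominating
    measure not involving [Q], and [K Q t] is an integral over [Q]; for
    [alpha = 0] this is one minus the mean log-likelihood. The gradient of the
    criterion is [P_t (r s) - Q (r s)] (lemmas [partial_Lam] and [partial_K]),
    and it vanishes at [T Q] ([estimating_equation]).

    At [Q = P_theta0] the criterion exceeds its value at [theta0] by the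
    integral of [p_theta0 r phi_alpha (p_t / p_theta0)]. Since the power
    function [phi_alpha] is positive except at [1] and the model is
    identifiable, [T P_theta0 = theta0] ([fisher_consistent]).

    Along the contamination [Q_e = (1 - e) P_theta0 + e delta_x] the estimating
    equation at [t_e = T Q_e] reads [(1 - e) A (t_e) + e B (t_e) = 0], where [A]
    is the gradient of the criterion at [P_theta0] and [B] that at [delta_x].
    As [A theta0 = 0], dividing by [e] and letting [e] tend to zero gives
    [DA (theta0) IF + B theta0 = 0] ([derive_perturbed_root]), and
    [B theta0 = P_theta0 (r s) - r (x) s (x)].

    It remains to identify the Hessian [DA (theta0)] with the escort information
    matrix ([criterion_hessian]). Pointwise the two integrands [l] and [q] of
    the criterion satisfy [dl = - p_t dq] with [dq = - r s], so that
    [ddl + p_theta0 ddq = - dp dq = p_theta0 r s s^t] by the product rule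
    alone.

    If [theta = theta0] or [alpha = 0] then [r = 1] wherever the score is not
    zero, so the escort information is the Fisher information; and the mean
    score vanishes because it is the gradient of [Lam] at [theta0], where [Lam]
    is maximal by [phi_(1 - alpha) >= 0] if [theta = theta0], and constant if
    [alpha = 0] ([partial_Lam_eq0]). *)

(** * Differentials along curves and local extrema *)

Section Differentials.
Context {R : realType} {V : normedModType R}.

Lemma derive_comp_scalar (f : V -> R) (g : R -> R) (x v : V) (dg : R) :
  differentiable f x -> is_derive (f x) 1 g dg ->
  'D_v (g \o f) x = dg * 'D_v f x.
Proof.
move=> df [dgx dgE].
have dg' : differentiable g (f x) by exact/derivable1_diffP.
rewrite deriveE; last exact: differentiable_comp.
by rewrite diff_comp//= diff1E// derive1E dgE deriveE// mulrC.
Qed.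

(** The curve [y] need only have a right derivative at [0], so the chain rule
    for two-sided derivatives does not apply; the remainder of [f] is absorbed
    because the rescaled increments of [y] stay bounded. *)
Lemma differentiable_along_curve (f : V -> R) (t w : V) (y : R -> V) :
  differentiable f t -> e^-1 *: (y e - t) @[e --> 0^'+] --> w ->
  e^-1 * (f (y e) - f t) @[e --> 0^'+] --> 'd f t w.
Proof.
move=> df yw.
pose r (h : V) : R := f (h + t) - f t - 'd f t h.
have ro n : 0 < n -> \forall h \near (0 : V), `|r h| <= n * `|h|.
  move=> n0; have /diff_locallyP [_ /eqaddoP /(_ n n0)] := df.
  by apply: filterS => h /=; rewrite /r !fctE /= opprD addrA.
have yt0 : y e - t @[e --> 0^'+] --> 0.
  rewrite -(scale0r w).
  have e0 : e @[e --> (0 : R)^'+] --> (0 : R).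
    by apply: cvg_at_right_filter; exact: cvg_id.
  apply: cvg_trans (cvgZ e0 yw); apply: near_eq_cvg; near=> e => /=.
  by rewrite scalerA mulfV ?scale1r// gt_eqF.
have dcont : {for w, continuous ('d f t)} by apply: diff_continuous.
have E1 : 'd f t (e^-1 *: (y e - t)) @[e --> 0^'+] --> 'd f t w.
  exact: cvg_comp yw dcont.
have E2 : e^-1 * r (y e - t) @[e --> 0^'+] --> (0 : R).
  apply/cvgr0Pnorm_lt => eps eps0.
  have w1 : 0 < `|w| + 1 by rewrite ltr_wpDl.
  have n0 : 0 < eps / (2 * (`|w| + 1)) by rewrite divr_gt0// mulr_gt0.
  have ybnd : \forall e \near 0^'+, `|e^-1 *: (y e - t)| < `|w| + 1.
    by apply: (cvgr_lt `|w| (cvg_norm yw)); rewrite ltrDl.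
  have rbnd := yt0 _ (ro _ n0).
  near=> e.
  have e0 : 0 < e by [].
  have : `|r (y e - t)| <= eps / (2 * (`|w| + 1)) * `|y e - t| by near: e.
  have : `|e^-1 *: (y e - t)| < `|w| + 1 by near: e.
  rewrite normrZ normrM gtr0_norm ?invr_gt0// => yB rB.
  apply: (@le_lt_trans _ _ (eps / (2 * (`|w| + 1)) * (e^-1 * `|y e - t|))).
    by rewrite mulrCA ler_pM2l ?invr_gt0.
  apply: (@lt_trans _ _ (eps / (2 * (`|w| + 1)) * (`|w| + 1))).
    by rewrite ltr_pM2l.
  rewrite invfM mulrA divfK ?gt_eqF//.
  by rewrite ltr_pdivrMr// ltr_pMr// ltr1n.
rewrite -[X in _ --> X]addr0.
apply: cvg_trans (cvgD E1 E2); apply: near_eq_cvg; near=> e.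
rewrite fctE /= /r subrK linearZ /= -mulrDr addrC subrK.
Unshelve. all: by end_near. Qed.

(** The difference quotients of [f] along a ray from [t] are nonpositive, so
    the differential is nonpositive in every direction and its opposite. *)
Lemma derive_local_max (f : V -> R) (t v : V) :
  differentiable f t -> (\forall u \near t, f u <= f t) -> 'D_v f t = 0.
Proof.
move=> df fmax; rewrite deriveE//.
have ray w : 'd f t w <= 0.
  pose y (e : R) := t + e *: w.
  have yw : e^-1 *: (y e - t) @[e --> 0^'+] --> w.
    apply: cvg_near_cst; near=> e.
    by rewrite /y addrC addKr scalerA mulVf ?scale1r// gt_eqF.
  have yt : y e @[e --> (0 : R)^'+] --> t.
    rewrite -[X in _ --> X]addr0 -(scale0r w).
    apply: cvgD; first exact: cvg_cst.
    apply: cvgZr_tmp; apply: cvg_at_right_filter; exact: cvg_id.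
  have cv := differentiable_along_curve df yw.
  rewrite -(cvg_lim _ cv)//; apply: limr_le; first by apply/cvg_ex; exists ('d f t w).
  have := yt _ fmax; rewrite near_simpl => fy.
  near=> e; apply: mulr_ge0_le0; first by rewrite invr_ge0.
  by rewrite subr_le0; near: e.
by apply/eqP; rewrite eq_le ray -oppr_le0 -linearN ray.
Unshelve. all: by end_near. Qed.

Lemma derive_local_min (f : V -> R) (t v : V) :
  differentiable f t -> (\forall u \near t, f t <= f u) -> 'D_v f t = 0.
Proof.
move=> df fmin; apply: oppr_inj; rewrite oppr0 -deriveN; last exact: diff_derivable.
apply: derive_local_max; first exact: differentiableN.
by apply: filterS fmin => u; rewrite lerN2.
Qed.

(** The first-order expansion of an implicit equation whose perturbed
    solutions leave [t] with velocity [w]: divide by [e] and let [e] tend to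
    zero from the right. *)
Lemma derive_perturbed_root (A B : V -> R) (t w : V) (y : R -> V) :
  differentiable A t -> {for t, continuous B} -> A t = 0 ->
  e^-1 *: (y e - t) @[e --> 0^'+] --> w ->
  (\forall e \near 0^'+, (1 - e) * A (y e) + e * B (y e) = 0) ->
  'D_w A t + B t = 0.
Proof.
move=> dA cB At0 yw root.
have e0 : e @[e --> (0 : R)^'+] --> (0 : R).
  by apply: cvg_at_right_filter; exact: cvg_id.
have yt : y e @[e --> 0^'+] --> t.
  rewrite -[X in _ --> X]addr0 -(scale0r w).
  apply: cvg_trans (cvgD (cvg_cst t) (cvgZ e0 yw)); apply: near_eq_cvg; near=> e.
  by rewrite fctE /= scalerA mulfV ?scale1r ?gt_eqF// addrC subrK.
have cA := differentiable_along_curve dA yw.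
have cAB : (1 - e) * (e^-1 * (A (y e) - A t)) + B (y e) @[e --> 0^'+] -->
    (1 - 0) * 'd A t w + B t.
  apply: cvgD; last exact: cvg_comp yt cB.
  by apply: cvgM => //; apply: cvgB => //; exact: cvg_cst.
rewrite deriveE// -['d A t w]mul1r -[X in X * _]subr0 -(cvg_lim _ cAB)//.
apply: lim_near_cst => //; near=> e.
have e_neq0 : e != 0 by rewrite gt_eqF.
rewrite At0 subr0 mulrCA; apply: (mulfI e_neq0).
rewrite mulr0 mulrDr mulVKf//; near: e; exact: root.
Unshelve. all: by end_near. Qed.

End Differentials.

Lemma near_eq_differentiable {R : realType} {V : normedModType R} (f g : V -> R) (t : V) :
  (\near t, f t = g t) -> differentiable f t -> differentiable g t.
Proof.
move=> fg df; have [dfc /eqaddoP dfo] := (diff_locallyP _ _).1 df.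
have gt : g t = f t by apply/esym; exact: nbhs_singleton fg.
have go : g \o shift t = cst (g t) + 'd f t +o_ (0 : V) id.
  apply/eqaddoP => e e0; have := dfo e e0; apply: filter_app.
  have := fg; rewrite (near_shift 0 t) subr0.
  by apply: filterS => h /= fgh; rewrite !fctE /= gt -fgh.
have dE : 'd g t = 'd f t :> (V -> R) by exact: diff_unique.
by apply/diff_locallyP; rewrite dE.
Qed.

Section PartialDerivatives.
Context {R : realType} {d : nat}.
Implicit Types (f g : 'cV[R]_d -> R) (t : 'cV[R]_d).

Lemma near_eq_partial f g t (i : 'I_d) :
  (\near t, f t = g t) -> \near t, partial i f t = partial i g t.
Proof.
move=> /nbhs_interior; apply: filterS => u fg; exact: near_eq_derive.
Qed.

Lemma near_eq_twice_differentiable f g t :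
  (\near t, f t = g t) -> twice_differentiable f t -> twice_differentiable g t.
Proof.
move=> fg [df ddf]; split.
  near=> u; apply: (@near_eq_differentiable _ _ f).
    by near: u; exact: nbhs_interior.
  by near: u.
by move=> i; apply: near_eq_differentiable (ddf i); exact: near_eq_partial.
Unshelve. all: by end_near. Qed.

Lemma derive_sum_partial f t (w : 'cV[R]_d) : differentiable f t ->
  'D_w f t = \sum_j w j 0 * partial j f t.
Proof.
move=> df; have {1}-> : w = \sum_j w j 0 *: delta_mx j 0.
  rewrite {1}(matrix_sum_delta w); apply: eq_bigr => j _.
  by rewrite big_ord1.
rewrite deriveE// linear_sum; apply: eq_bigr => j _.
by rewrite linearZ /= /partial deriveE.
Qed.

End PartialDerivatives.

(** * Power functions and the integrands as functions of a density value *)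

Section PowerDivergence.
Context {R : realType}.
Implicit Types a c y v : R.

Definition dphi a v : R := if a == 1 then ln v else (v `^ (a - 1) - 1) / (a - 1).

Lemma is_derive_phi a v : 0 < v -> is_derive v 1 (phi a) (dphi a v).
Proof.
move=> v0; rewrite /dphi; have dl := is_derive1_ln v0.
have [->|a1] := eqVneq a 1.
  have -> : phi (1 : R) = (id * @ln R - id + cst 1 : R -> R).
    by apply/funext => t; rewrite /phi oner_eq0 eqxx !fctE.
  apply: is_derive_eq; rewrite addr0 /GRing.scale /= mulfV ?gt_eqF// mulr1; ring.
have [->|a0] := eqVneq a 0.
  have -> : phi (0 : R) = (- @ln R + id - cst 1 : R -> R).
    by apply/funext => t; rewrite /phi eqxx !fctE.
  apply: is_derive_eq; rewrite sub0r powR_inv1 ?ltW//.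
  by rewrite invrN invr1 mulrN1 opprB subr0 addrC.
have -> : phi a = (a * (a - 1))^-1 \*: ((@powR R) ^~ a - a \*: id + cst (a - 1)).
  apply/funext => t; rewrite /phi (negbTE a0) (negbTE a1) !fctE /=.
  by rewrite /GRing.scale /= mulrC addrA.
have dp := is_derive1_powR a v0.
apply: is_derive_eq; rewrite /GRing.scale /= !mulr1 addr0.
have a10 : a - 1 != 0 by rewrite subr_eq0.
by field; rewrite a10 a0.
Qed.

Lemma dphi_gt0 a v : 1 < v -> 0 < dphi a v.
Proof.
move=> v1; rewrite /dphi; case: eqVneq => [_|a1]; first exact: ln_gt0.
have lv := ln_gt0 v1; rewrite /powR gt_eqF ?(lt_trans _ v1)//.
have [b0|b0|/eqP] := ltgtP (a - 1) 0; last by rewrite subr_eq0 (negbTE a1).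
  by rewrite nmulr_lgt0 ?invr_lt0// subr_lt0 expR_lt1 nmulr_rlt0.
by rewrite divr_gt0// subr_gt0 expR_gt1 mulr_gt0.
Qed.

Lemma dphi_lt0 a v : 0 < v < 1 -> dphi a v < 0.
Proof.
move=> v01; rewrite /dphi; case: eqVneq => [_|a1]; first exact: ln_lt0.
have lv := ln_lt0 v01; case/andP: v01 => v0 v1; rewrite /powR gt_eqF//.
have [b0|b0|/eqP] := ltgtP (a - 1) 0; last by rewrite subr_eq0 (negbTE a1).
  by rewrite nmulr_llt0 ?invr_lt0// subr_gt0 expR_gt1 nmulr_rgt0.
by rewrite pmulr_llt0 ?invr_gt0// subr_lt0 expR_lt1 pmulr_rlt0.
Qed.

Lemma phi1 a : phi a 1 = 0.
Proof.
rewrite /phi ln1 powR1; case: eqP => [_|_]; first by ring.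
case: eqP => [_|_]; first by ring.
by rewrite (_ : 1 - _ + _ - 1 = 0) ?mul0r//; ring.
Qed.

Lemma phi_gt0 a v : 0 < v -> v != 1 -> 0 < phi a v.
Proof.
move=> v0; rewrite neq_lt => /orP[v1|v1].
  have D x : x \in `]v, 1[ -> is_derive x 1 (phi a) (dphi a x).
    by rewrite in_itv => /andP[vx _]; apply: is_derive_phi; exact: lt_trans vx.
  have C : {within `[v, 1], continuous (phi a)}.
    apply: derivable_within_continuous => x; rewrite in_itv => /andP[vx _].
    by have [] := is_derive_phi a (lt_le_trans v0 vx).
  have [x] := MVT v1 D C; rewrite in_itv /= => /andP[vx x1].
  rewrite phi1 sub0r => /(canRL opprK) ->.
  by rewrite oppr_gt0 pmulr_llt0 ?subr_gt0// dphi_lt0// x1 (lt_trans v0 vx).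
have D x : x \in `]1, v[ -> is_derive x 1 (phi a) (dphi a x).
  by rewrite in_itv => /andP[vx _]; apply: is_derive_phi; exact: lt_trans vx.
have C : {within `[1, v], continuous (phi a)}.
  apply: derivable_within_continuous => x; rewrite in_itv => /andP[vx _].
  by have [] := is_derive_phi a (lt_le_trans ltr01 vx).
have [x] := MVT v1 D C; rewrite in_itv /= => /andP[vx x1].
by rewrite phi1 subr0 => ->; rewrite mulr_gt0 ?subr_gt0// dphi_gt0.
Qed.

Lemma phi_ge0 a v : 0 < v -> 0 <= phi a v.
Proof. by move=> v0; have [->|/(phi_gt0 a v0)/ltW//] := eqVneq v 1; rewrite phi1. Qed.

(** [lam_link a c y] and [Q_link a c y] are the values of [lam_integrand] and
    [Q_integrand] at a point where the escort density is [c] and the density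
    of the parameter is [y]. *)
Definition lam_link a c y : R :=
  if a == 0 then y
  else if a == 1 then c * ln (y / c)
  else (1 - a)^-1 * (y * (c / y) `^ a).

Definition Q_link a c y : R := if a == 0 then - ln y else a^-1 * (c / y) `^ a.

Lemma is_derive_powR_div a c y : 0 < c -> 0 < y ->
  is_derive y 1 (fun z => (c / z) `^ a) (- a * ((c / y) `^ a / y)).
Proof.
move=> c0 y0; have cy0 : 0 < c * y^-1 by rewrite divr_gt0.
have dV : is_derive y 1 (fun z => c * z^-1) (c * - y ^- 2).
  have y_neq0 : y != 0 by rewrite gt_eqF.
  have dI : is_derive y 1 (fun z : R => z^-1) (- y ^- 2).
    by apply: is_derive_eq (is_deriveV y_neq0 (is_derive_id _ _)) _; rewrite /GRing.scale /= mulr1.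
  by have := is_deriveZ c dI.
have dP : is_derive (c * y^-1) 1 (((@powR R) ^~ a)) (a * (c * y^-1) `^ (a - 1)).
  exact: is_derive1_powR.
have := @is_derive1_comp _ ((@powR R) ^~ a) (fun z : R => c * z^-1) y _ _ dP dV.
move=> H; apply: (@is_derive_eq _ _ _ _ _ _ _ _ H).
rewrite powRB; last by rewrite (gt_eqF cy0) implybT.
have cN : c != 0 by rewrite gt_eqF.
have yN : y != 0 by rewrite gt_eqF.
by rewrite powRr1 ?ltW//; field; rewrite cN yN.
Qed.

Lemma is_derive_Q_link a c y : 0 < c -> 0 < y ->
  is_derive y 1 (Q_link a c) (- ((c / y) `^ a / y)).
Proof.
move=> c0 y0; rewrite /Q_link; have [->|a0] := eqVneq a 0.
  rewrite powRr0 div1r; by have dl := is_derive1_ln y0; exact: (@is_deriveN _ _ _ (@ln R) _ _ _ dl).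
have dP := is_derive_powR_div a c0 y0.
have -> : (fun z => a^-1 * (c / z) `^ a) = a^-1 \*: (fun z => (c / z) `^ a) by [].
by apply: is_derive_eq; rewrite /GRing.scale /=; field; rewrite a0 gt_eqF.
Qed.

Lemma is_derive_lam_link a c y : 0 < c -> 0 < y ->
  is_derive y 1 (lam_link a c) ((c / y) `^ a).
Proof.
move=> c0 y0; rewrite /lam_link; have [->|a0] := eqVneq a 0.
  rewrite powRr0; exact: is_derive_id.
have [->|a1] := eqVneq a 1.
  apply: (@near_eq_is_derive _ _ _ (c \*: (@ln R - cst (ln c)))).
    near=> z; rewrite !fctE ln_div ?posrE//.
    by near: z; exact: lt_nbhsr.
  have dl := is_derive1_ln y0.
  by apply: is_derive_eq; rewrite subr0 powRr1 ?divr_ge0 ?ltW.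
have dP := is_derive_powR_div a c0 y0.
have -> : (fun z => (1 - a)^-1 * (z * (c / z) `^ a)) =
  (1 - a)^-1 \*: (id * (fun z => (c / z) `^ a)) by [].
apply: is_derive_eq; rewrite /GRing.scale /= !mulr1.
have a10 : 1 - a != 0 by rewrite subr_eq0 eq_sym.
by field; rewrite a10 gt_eqF.
Unshelve. all: by end_near. Qed.

(** This identity makes the criterion a divergence: integrated over [x] with
    [y0] the density of the true parameter, its left-hand side is the excess of
    the criterion at the parameter with density [y]. *)
Lemma link_subE a c y0 y : 0 < c -> 0 < y0 -> 0 < y ->
  (lam_link a c y + y0 * Q_link a c y) - (lam_link a c y0 + y0 * Q_link a c y0)
  = y0 * ((c / y) `^ a * phi a (y / y0)).
Proof.
move=> c0 y00 y_gt0.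
have y0N : y0 != 0 by rewrite gt_eqF.
have yN : y != 0 by rewrite gt_eqF.
rewrite /lam_link /Q_link /phi; have [->|a0] := eqVneq a 0.
  by rewrite powRr0 ln_div ?posrE//; field.
have [->|a1] := eqVneq a 1.
  rewrite !powRr1 ?divr_ge0 ?ltW// !ln_div ?posrE//.
  by field; rewrite y0N yN.
have cN : c != 0 by rewrite gt_eqF.
have -> : (c / y0) `^ a = (c / y) `^ a * (y / y0) `^ a.
  by rewrite -powRM ?divr_ge0 ?ltW// mulrA divfK.
have a1N : a - 1 != 0 by rewrite subr_eq0.
have a1N' : 1 - a != 0 by rewrite subr_eq0 eq_sym.
by field; rewrite ?a0 ?a1N ?a1N' ?y0N ?yN.
Qed.

(** [lam_link a c] lies below its tangent [y - c + const] at [y = c], the gap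
    being the power function of the complementary exponent. *)
Lemma lam_link_subE a c y : 0 < c -> 0 < y ->
  lam_link a c y - lam_link a c c = y - c - a * (c * phi (1 - a) (y / c)).
Proof.
move=> c0 y0.
have cN : c != 0 by rewrite gt_eqF.
have yN : y != 0 by rewrite gt_eqF.
rewrite /lam_link /phi; have [->|a0] := eqVneq a 0.
  by rewrite mul0r subr0.
have [->|a1] := eqVneq a 1.
  by rewrite subrr eqxx mulfV// ln1; field.
have a1N : 1 - a != 0 by rewrite subr_eq0 eq_sym.
have a0N : 1 - a != 1 by rewrite -subr_eq0 addrAC subrr sub0r oppr_eq0.
rewrite (negbTE a1N) (negbTE a0N) mulfV// powR1.
have -> : (c / y) `^ a = (y / c) `^ (- a).
  have yc0 : 0 <= y / c by rewrite divr_ge0 ?ltW.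
  by rewrite -[c / y]invf_div -(powR_inv1 yc0) -powRrM mulN1r.
have -> : (y / c) `^ (1 - a) = y / c * (y / c) `^ (- a).
  by rewrite powRD ?powRr1 ?divr_ge0 ?ltW//; rewrite (gt_eqF (divr_gt0 _ _)) ?implybT.
have a0N' : 1 - a - 1 != 0 by rewrite addrAC subrr sub0r oppr_eq0.
by field; rewrite ?cN ?a0N' ?a1N.
Qed.

End PowerDivergence.

(** * Gradients of the integrands *)

Section LinkGradients.
Context {R : realType} {V : normedModType R}.
Variables (f : V -> R) (t : V).
Hypothesis df : differentiable f t.

(** Were the difference quotients of [ln \o f] along [v] convergent, [ln (f u)]
    would tend to [ln 0 = 0] while [f u] tends to [0]; as [ln] is below [-1] on
    positive arguments close to [0], [f] would vanish along the ray and the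
    limit would be [0]. Otherwise ['D_v] takes its default value [0]. *)
Lemma derive_ln_at_zero (v : V) : f t = 0 -> 'D_v (fun u => ln (f u)) t = 0.
Proof.
move=> ft0; rewrite /derive; set q := (fun h : R => _).
have [/cvg_ex [l ql]|/dvgP -> //] := pselect (cvg (q @ 0^')).
have h0 : h @[h --> (0 : R)^'] --> (0 : R).
  by apply: cvg_within_filter; exact: cvg_id.
have lnf0 : ln (f (h *: v + t)) @[h --> (0 : R)^'] --> (0 : R).
  rewrite -[X in _ --> X](mul0r l); apply: cvg_trans (cvgM h0 ql).
  apply: near_eq_cvg; near=> h.
  have hN : h != 0 by near: h; exact: nbhs_dnbhs_neq.
  by rewrite /q /= ft0 [ln 0]ln0// subr0 /GRing.scale /= mulrA mulfV// mul1r.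
have f0 : f (h *: v + t) @[h --> (0 : R)^'] --> (0 : R).
  have ray : h *: v + t @[h --> (0 : R)^'] --> t.
    rewrite -[X in _ --> X]add0r -(scale0r v).
    by apply: cvgD; [exact: cvgZr_tmp|exact: cvg_cst].
  rewrite -[X in _ --> X]ft0; exact: cvg_comp ray (differentiable_continuous df).
apply: lim_near_cst => //.
have e1 : 0 < expR (-1) :> R by exact: expR_gt0.
have N1 : \forall h \near (0 : R)^', -1 < ln (f (h *: v + t)).
  by apply: (cvgr_gt 0 lnf0); rewrite ltrN10.
have N2 : \forall h \near (0 : R)^', f (h *: v + t) < expR (-1).
  exact: (cvgr_lt 0 f0).
near=> h; rewrite /q ft0 [ln 0]ln0// subr0 /=.
suff -> : ln (f (h *: v + t)) = 0 by rewrite scaler0.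
have [fneg|fpos] := leP (f (h *: v + t)) 0; first exact: ln0.
have : -1 < ln (f (h *: v + t)) by near: h.
rewrite -[X in X < _](expRK (-1)) ltr_ln ?posrE// ltNge.
by case/negP; apply: ltW; near: h.
Unshelve. all: by end_near. Qed.

Variables (a c : R).
Hypotheses (a0 : 0 <= a) (c0 : 0 <= c) (f0 : 0 <= f t).

Lemma derive_ln_comp (v : V) : 0 < f t ->
  'D_v (fun u => ln (f u)) t = (f t)^-1 * 'D_v f t.
Proof.
by move=> f_gt0; apply: (derive_comp_scalar (g := @ln R)) => //; exact: is_derive1_ln.
Qed.

(** Where the ratio [c / f t] degenerates to [0], [Q_link a c (f u)] attains
    there its least value [0], so that both sides vanish. *)
Lemma derive_Q_link (v : V) :
  differentiable (fun u => Q_link a c (f u)) t ->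
  'D_v (fun u => Q_link a c (f u)) t =
  - ((c / f t) `^ a * 'D_v (fun u => ln (f u)) t).
Proof.
move=> dQ; have [a_eq0|aN] := eqVneq a 0.
  have lnE : (fun u => ln (f u)) = - (fun u => Q_link a c (f u)).
    by apply/funext => u; rewrite fctE /Q_link a_eq0 eqxx opprK.
  rewrite [X in (c / f t) `^ X]a_eq0 powRr0 mul1r lnE deriveN ?opprK//.
  exact: diff_derivable.
have [r0|rN] := eqVneq (c / f t) 0.
  rewrite r0 powR0// mul0r oppr0; apply: derive_local_min => //.
  apply: nearW => u; rewrite /Q_link (negbTE aN) r0 powR0// mulr0.
  by rewrite mulr_ge0 ?invr_ge0 ?powR_ge0.
move: rN; rewrite mulf_eq0 invr_eq0 negb_or => /andP[cN fN].
have c_gt0 : 0 < c by rewrite lt_def cN.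
have f_gt0 : 0 < f t by rewrite lt_def fN.
rewrite (derive_comp_scalar (f := f) (g := Q_link a c) v df (is_derive_Q_link a c_gt0 f_gt0)).
by rewrite derive_ln_comp// mulrA mulNr.
Qed.

Lemma derive_lam_link (v : V) : 0 < c -> 0 < f t ->
  'D_v (fun u => lam_link a c (f u)) t =
  f t * ((c / f t) `^ a * 'D_v (fun u => ln (f u)) t).
Proof.
move=> c_gt0 f_gt0.
rewrite (derive_comp_scalar (f := f) (g := lam_link a c) v df (is_derive_lam_link a c_gt0 f_gt0)).
by rewrite derive_ln_comp// mulrCA mulVKf// gt_eqF.
Qed.

End LinkGradients.

(** * Integration against densities and contaminated measures *)

Section Density.
Context {disp : measure_display} {X : measurableType disp} {R : realType}.
Variables (lam : {sigma_finite_measure set X -> \bar R}) (Q : probability X R).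
Variable q : X -> R.
Hypotheses (mq : measurable_fun setT q) (q0 : forall x, 0 <= q x).
Hypothesis Qq : forall A, measurable A -> Q A = (\int[lam]_(x in A) (q x)%:E)%E.

Let mqE : measurable_fun setT (EFin \o q).
Proof. exact/measurable_EFinP. Qed.

Lemma density_dominated : Q `<< lam.
Proof.
apply/null_content_dominatesP => A mA A0; rewrite Qq//.
by apply: null_set_integral => //; exact: measurable_funTS.
Qed.

Lemma density_integrable : lam.-integrable setT (EFin \o q).
Proof.
apply/integrableP; split => //.
under eq_integral do rewrite /= ger0_norm//.
by rewrite -Qq// probability_setT ltry.
Qed.

Lemma ge0_integral_density (f : X -> \bar R) :
  (forall x, (0 <= f x)%E) -> measurable_fun setT f ->
  (\int[Q]_x f x = \int[lam]_x (f x * (q x)%:E))%E.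
Proof.
move=> f0 mf; pose g := Radon_Nikodym_SigmaFinite.f Q lam.
have Ql := density_dominated.
rewrite -(Radon_Nikodym_SigmaFinite.change_of_variables Ql f0 measurableT mf).
have gq : ae_eq lam setT g (EFin \o q).
  apply: integral_ae_eq => //; first exact: Radon_Nikodym_SigmaFinite.f_integrable.
  move=> A _ mA; transitivity (Q A); last exact: Qq.
  exact/esym/Radon_Nikodym_SigmaFinite.f_integral.
have mg : measurable_fun setT g.
  exact: measurable_int (Radon_Nikodym_SigmaFinite.f_integrable Ql).
apply: ae_eq_integral => //; [exact: emeasurable_funM..|].
exact: ae_eqe_mul2l.
Qed.

(** Multiplication by the nonnegative [q] commutes with taking positive and
    negative parts, which reduces the identity to nonnegative functions. *)
Lemma integral_density (f : X -> \bar R) : measurable_fun setT f ->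
  (\int[Q]_x f x = \int[lam]_x (f x * (q x)%:E))%E.
Proof.
move=> mf; rewrite integralE [RHS]integralE.
have q0E x : (0 <= (q x)%:E)%E by rewrite lee_fin.
have fposM : (fun x => f x * (q x)%:E)^\+%E = (fun x => f^\+ x * (q x)%:E)%E.
  by apply/funext => x; rewrite !funeposE maxe_pMl// mul0e.
have fnegM : (fun x => f x * (q x)%:E)^\-%E = (fun x => f^\- x * (q x)%:E)%E.
  by apply/funext => x; rewrite !funenegE -mulNe maxe_pMl// mul0e.
rewrite fposM fnegM !ge0_integral_density//.
- exact: measurable_funeneg.
- exact: measurable_funepos.
Qed.

Lemma Rintegral_density (f : X -> R) : measurable_fun setT f ->
  \int[Q]_x f x = \int[lam]_x (q x * f x).
Proof.
move=> mf; rewrite /Rintegral integral_density; last exact/measurable_EFinP.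
by congr fine; apply: eq_integral => x _; rewrite -EFinM mulrC.
Qed.

Lemma integrable_density (f : X -> R) :
  Q.-integrable setT (EFin \o f) ->
  lam.-integrable setT (EFin \o (fun x => q x * f x)).
Proof.
move=> /integrableP[mf fi]; apply/integrableP; split.
  by apply/measurable_EFinP/measurable_funM => //; exact/measurable_EFinP.
move: fi; rewrite ge0_integral_density//; last exact: measurableT_comp.
by congr (_ < _)%E; apply: eq_integral => x _; rewrite /= normrM (ger0_norm (q0 x)) mulrC.
Qed.

End Density.

Lemma Rintegral_ae_eq {d} {X : measurableType d} {R : realType}
    (mu : {measure set X -> \bar R}) (f g : X -> R) :
  measurable_fun setT f -> measurable_fun setT g ->
  {ae mu, forall x, f x = g x} -> \int[mu]_x f x = \int[mu]_x g x.
Proof.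
move=> mf mg fg; congr fine; apply: ae_eq_integral => //; try exact/measurable_EFinP.
by apply: filterS fg => x -> _.
Qed.

Section Contaminate.
Context {disp : measure_display} {X : measurableType disp} {R : realType}.
Variables (Q : probability X R) (x : X) (e : R).
Hypotheses (e0 : 0 <= e) (e1 : e <= 1).

Lemma ge0_integral_contaminate (f : X -> \bar R) :
  (forall x, (0 <= f x)%E) -> measurable_fun setT f ->
  (\int[contaminate Q x e]_y f y = (1 - e)%:E * \int[Q]_y f y + e%:E * f x)%E.
Proof.
move=> f0 mf; rewrite ge0_integral_measure_add//.
rewrite !ge0_integral_mscale// integral_dirac// diracT mul1e.
by rewrite /= clamp01_id.
Qed.

Lemma Rintegral_contaminate (f : X -> R) : Q.-integrable setT (EFin \o f) ->
  \int[contaminate Q x e]_y f y = (1 - e) * \int[Q]_y f y + e * f x.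
Proof.
move=> fi; have mf := measurable_int _ fi.
rewrite /Rintegral [in LHS]integralE.
have mfp := measurable_funepos mf; have mfn := measurable_funeneg mf.
rewrite !ge0_integral_contaminate// [in RHS]integralE.
have fpi : (\int[Q]_y (EFin \o f)^\+ y)%E \is a fin_num.
  by apply: integrable_fin_num => //; exact: integrable_funepos.
have fni : (\int[Q]_y (EFin \o f)^\- y)%E \is a fin_num.
  by apply: integrable_fin_num => //; exact: integrable_funeneg.
rewrite -(fineK fpi) -(fineK fni).
have -> : f x = Num.max (f x) 0 - Num.max (- f x) 0.
  by rewrite -{1}(funrposBneg f) fctE /= /funrpos /funrneg.
rewrite !funeposE !funenegE /= -!EFin_max -!EFinM -!EFinD /=.
ring.
Qed.

End Contaminate.

(** On nonnegative reals the inverse is the power function of exponent [-1],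
    which is measurable. *)
Lemma measurable_fun_invr_ge0 {d} {X : measurableType d} {R : realType}
    (f : X -> R) : (forall x, 0 <= f x) ->
  measurable_fun setT f -> measurable_fun setT (fun x => (f x)^-1).
Proof.
move=> f0 mf.
have -> : (fun x => (f x)^-1) = (@powR R)^~ (-1) \o f.
  by apply/funext => x /=; rewrite powR_inv1.
by apply: measurableT_comp mf; exact: measurable_powR.
Qed.

Section AlmostEverywhere.
Context {d : measure_display} {X : measurableType d} {R : realType}.
Variable mu : {measure set X -> \bar R}.

Lemma Rintegral_ae_ge0 (f : X -> R) : measurable_fun setT f ->
  {ae mu, forall x, 0 <= f x} -> 0 <= \int[mu]_x f x.
Proof.
move=> mf f0; rewrite (@Rintegral_ae_eq _ _ _ mu f (fun x => `|f x|)) //.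
- exact: Rintegral_ge0.
- exact: measurableT_comp.
- by apply: filterS f0 => x ?; rewrite ger0_norm.
Qed.

Lemma ae_eq0_Rintegral_le0 (f : X -> R) : mu.-integrable setT (EFin \o f) ->
  {ae mu, forall x, 0 <= f x} -> \int[mu]_x f x <= 0 ->
  {ae mu, forall x, f x = 0}.
Proof.
move=> fi f0 intf; have mf : measurable_fun setT f.
  by apply/measurable_EFinP; exact: measurable_int fi.
have mfE : measurable_fun setT (EFin \o f) by exact/measurable_EFinP.
have absf : (\int[mu]_x `|(f x)%:E| = 0)%E.
  have absE : \int[mu]_x `|f x| = \int[mu]_x f x.
    apply: Rintegral_ae_eq => //; first exact: measurableT_comp.
    by apply: filterS f0 => x ?; rewrite ger0_norm.
  have abs0 : \int[mu]_x `|f x| = 0.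
    by apply/eqP; rewrite eq_le Rintegral_ge0// absE intf.
  move: abs0; rewrite /Rintegral /= => abs0.
  have absfin : (\int[mu]_x (`|f x|)%:E)%E \is a fin_num.
    by apply: integrable_fin_num => //; exact: (integrable_norm fi).
  by rewrite -[LHS](fineK absfin) abs0.
have := (ae_eq_integral_abs mu measurableT mfE).1 absf.
by apply: filterS => x /(_ I) [].
Qed.

End AlmostEverywhere.

(** * The estimators and their influence functions *)

Section Model.
Context {R : realType} {d : nat}.
Context {disp : measure_display} {X : measurableType disp}.
Variables (lam : {sigma_finite_measure set X -> \bar R}).
Variables (Theta : set 'cV[R]_d) (P : 'cV[R]_d -> probability X R).
Variables (p : 'cV[R]_d -> X -> R) (P0 : probability X R).
Variables (a : R) (th : 'cV[R]_d) (T : probability X R -> 'cV[R]_d).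
Hypothesis model : standard_model lam Theta P p P0.
Hypothesis a0 : 0 <= a.
Hypothesis Th : Theta th.
Let C := mixtures (calQ Theta P P0).
Hypothesis smooth : smooth_model P p a th lam Theta C T.

(* [r] is the escort weight, [s i] the i-th coordinate of the score. *)
Let r t x := (p th x / p t x) `^ a.
Let s i t x := partial i (fun u => ln (p u x)) t.
Let dQ i x := partial i (fun u => Q_integrand p a th u x).
Let dlam i x := partial i (fun u => lam_integrand p a th u x).

Lemma model_nbhs t : Theta t -> \forall u \near t, Theta u.
Proof. by move=> Tt; apply: open_nbhs_nbhs; split => //; exact: model_open model. Qed.

(** A mixture carries a contamination point even when its weight is [0]; this
    is where [X] must be inhabited. *)
Lemma mixtures_model (x : X) t : Theta t -> C (P t).
Proof.
move=> Tt; exists (P t), x, 0; split => //; first by apply: Or31; exists t.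
by move=> A mA; rewrite subr0 mul1e mul0e adde0.
Qed.

Lemma mixtures_dirac (x : X) : C (\d_x : probability X R).
Proof.
exists (\d_x : probability X R), x, 0; split => //; last first.
  by move=> A mA; rewrite subr0 mul1e mul0e adde0.
apply: Or33; exists 0%N, (fun=> x) => A mA.
by rewrite big_ord1 invr1 mul1e.
Qed.

Lemma mixtures_contaminate (x : X) t e : Theta t -> 0 <= e -> e <= 1 ->
  C (contaminate (P t) x e).
Proof.
move=> Tt e0 e1; exists (P t), x, e; split => //; first by apply: Or31; exists t.
by move=> A mA; exact: contaminateE.
Qed.

Lemma density_gt0_ae t : Theta t -> {ae lam, forall x, 0 < p th x /\ 0 < p t x}.
Proof.
move=> Tt; have := model_equiv model Th Tt; apply: filterS => x.
have := model_dens_ge0 model x Th; have := model_dens_ge0 model x Tt.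
rewrite le_eqVlt => /predU1P[<-|t0]; first by rewrite mulr0 ltxx.
by rewrite pmulr_lgt0.
Qed.

Lemma Rintegral_model t (f : X -> R) : Theta t -> measurable_fun setT f ->
  \int[P t]_x f x = \int[lam]_x (p t x * f x).
Proof.
move=> Tt; exact: (Rintegral_density (model_dens_meas model Tt)
  (fun x => model_dens_ge0 model x Tt) (fun A => model_dens model Tt)).
Qed.

Lemma integrable_model t (f : X -> R) : Theta t ->
  (P t).-integrable setT (EFin \o f) ->
  lam.-integrable setT (EFin \o (fun x => p t x * f x)).
Proof.
move=> Tt; exact: (integrable_density (model_dens_meas model Tt)
  (fun x => model_dens_ge0 model x Tt) (fun A => model_dens model Tt)).
Qed.

(** Applied to the Dirac measure at [x], the regularity of the integrals of
    the [Q_integrand] is a pointwise regularity at [x]. *)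
Lemma Q_integrand_twice_differentiable x t : Theta t ->
  twice_differentiable (fun u => Q_integrand p a th u x) t.
Proof.
move=> Tt; have Cx := mixtures_dirac x.
apply: near_eq_twice_differentiable (interchange_diff (smooth_Q smooth Cx Tt)).
apply: filterS (model_nbhs Tt) => u Tu.
have mf := measurable_int _ (interchange_int (smooth_Q smooth Cx Tu)).
by rewrite /Rintegral integral_dirac// diracT mul1e.
Qed.

Lemma partial_Q_integrand i t x : Theta t -> dQ i x t = - (r t x * s i t x).
Proof.
move=> Tt; have [/nbhs_singleton dp _] := smooth_dens smooth x Tt.
have [/nbhs_singleton dq _] := Q_integrand_twice_differentiable x Tt.
have := derive_Q_link dp a0 (model_dens_ge0 model x Th) (model_dens_ge0 model x Tt).
by apply.
Qed.

Lemma partial_lam_integrand i t x : Theta t -> 0 < p th x -> 0 < p t x ->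
  dlam i x t = p t x * (r t x * s i t x).
Proof.
move=> Tt th0 t0; have [/nbhs_singleton dp _] := smooth_dens smooth x Tt.
exact: derive_lam_link.
Qed.

Lemma score_at_zero i t x : Theta t -> p t x = 0 -> s i t x = 0.
Proof.
move=> Tt pt0; have [/nbhs_singleton dp _] := smooth_dens smooth x Tt.
exact: derive_ln_at_zero.
Qed.

Lemma integrable_escort_score i Q t : C Q -> Theta t ->
  Q.-integrable setT (EFin \o (fun x => r t x * s i t x)).
Proof.
move=> CQ Tt; have := integrableN (interchange_int1 (smooth_Q smooth CQ Tt) i).
apply: eq_integrable => // x _.
by rewrite /= [partial i _ t](partial_Q_integrand i x Tt) opprK.
Qed.

(* The criterion [Lam + K Q] is [M] for [a] positive, and one minus the mean
   log-likelihood for [a = 0]. *)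
Let Lam u := \int[lam]_x lam_integrand p a th u x.
Let K (Q : probability X R) u := \int[Q]_x Q_integrand p a th u x.

Lemma partial_K i Q t : C Q -> Theta t ->
  partial i (K Q) t = - \int[Q]_x (r t x * s i t x).
Proof.
move=> CQ Tt; rewrite (interchange1 (smooth_Q smooth CQ Tt)).
under eq_Rintegral do rewrite [partial _ _ _](partial_Q_integrand i _ Tt) -mulN1r.
by rewrite RintegralZl// ?mulN1r//; exact: integrable_escort_score.
Qed.

Lemma partial_Lam i (x0 : X) t : Theta t ->
  partial i Lam t = \int[P t]_x (r t x * s i t x).
Proof.
move=> Tt; rewrite (interchange1 (smooth_lam smooth Tt)).
have mrs : measurable_fun setT (fun x => r t x * s i t x).
  apply/measurable_EFinP.
  exact: measurable_int (integrable_escort_score i (mixtures_model x0 Tt) Tt).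
rewrite Rintegral_model//; apply: Rintegral_ae_eq.
- apply/measurable_EFinP.
  exact: measurable_int (interchange_int1 (smooth_lam smooth Tt) i).
- exact: (measurable_funM (model_dens_meas model Tt) mrs).
- by apply: filterS (density_gt0_ae Tt) => x [th0 t0]; exact: partial_lam_integrand.
Qed.

Lemma Rintegral_dens t : Theta t -> \int[lam]_x p t x = 1.
Proof. by move=> Tt; rewrite /Rintegral -(model_dens model)// probability_setT. Qed.

Lemma dens_integrable t : Theta t -> lam.-integrable setT (EFin \o p t).
Proof.
move=> Tt; exact: (density_integrable (model_dens_meas model Tt)
  (fun x => model_dens_ge0 model x Tt) (fun A => model_dens model Tt)).
Qed.

(** [Lam] is, up to a constant, a negative divergence of [P t] from the escort
    [P th], hence is maximal at [th]; for [a = 0] it is the total mass [1]. *)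
Lemma partial_Lam_eq0 i t : Theta t -> a = 0 \/ t = th -> partial i Lam t = 0.
Proof.
move=> Tt at_th; have [/nbhs_singleton dL _] := interchange_diff (smooth_lam smooth Tt).
apply: derive_local_max => //; apply: filterS (model_nbhs Tt) => u Tu.
have li v : Theta v -> lam.-integrable setT (EFin \o lam_integrand p a th v).
  by move=> Tv; exact: interchange_int (smooth_lam smooth Tv).
pose f x := (p u x - p t x) - (lam_integrand p a th u x - lam_integrand p a th t x).
have pB : lam.-integrable setT (EFin \o (fun x => p u x - p t x)).
  exact: (integrableB measurableT (dens_integrable Tu) (dens_integrable Tt)).
have lB : lam.-integrable setT
    (EFin \o (fun x => lam_integrand p a th u x - lam_integrand p a th t x)).
  exact: (integrableB measurableT (li _ Tu) (li _ Tt)).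
have fE : \int[lam]_x f x = - (Lam u - Lam t).
  rewrite RintegralB// RintegralB// ?RintegralB//; try exact: dens_integrable; try exact: li.
  by rewrite !Rintegral_dens// subrr sub0r.
rewrite -subr_le0 -oppr_ge0 -fE; apply: Rintegral_ae_ge0.
  apply: measurable_funB; apply/measurable_EFinP.
    exact: measurable_int pB.
  exact: measurable_int lB.
apply: filterS2 (density_gt0_ae Tt) (density_gt0_ae Tu) => x [th0 t0] [_ u0].
rewrite /f; case: at_th => [a_eq0|t_th].
  by rewrite /lam_integrand a_eq0 eqxx subrr.
have := lam_link_subE a th0 u0; rewrite t_th.
rewrite -[lam_link a (p th x) (p u x)]/(lam_integrand p a th u x).
rewrite -[lam_link a (p th x) (p th x)]/(lam_integrand p a th th x) => ->.
by rewrite opprB addrCA subrr addr0 mulr_ge0// mulr_ge0 ?phi_ge0 ?divr_gt0// ltW.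
Qed.

(** For [a = 0] the gradient of [Lam] is absent from [Psi]; it is zero. *)
Lemma estimating_equation i (x0 : X) Q : C Q -> Theta (T Q) ->
  partial i Lam (T Q) + partial i (K Q) (T Q) = 0.
Proof.
move=> CQ TQ; have /matrixP/(_ i 0) := smooth_equation smooth CQ.
rewrite partial_K// /Psi; have [a_eq0|aN] := eqVneq a 0.
  rewrite partial_Lam_eq0//; last by left.
  rewrite !mxE sub0r => E; rewrite -[RHS]oppr0; congr (- _); rewrite -[RHS]E.
  by apply: eq_Rintegral => x _; rewrite /r a_eq0 powRr0 mul1r /score mxE.
rewrite (partial_Lam i x0)// !mxE => <-.
by congr (_ - _); apply: eq_Rintegral => x _; rewrite /score mxE.
Qed.

Lemma measurable_ratio t : Theta t -> measurable_fun setT (fun x => p th x / p t x).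
Proof.
move=> Tt; apply: (measurable_funM (model_dens_meas model Th)).
exact: (measurable_fun_invr_ge0 (fun x => model_dens_ge0 model x Tt)
  (model_dens_meas model Tt)).
Qed.

Lemma measurable_r t : Theta t -> measurable_fun setT (r t).
Proof.
move=> Tt; apply: (measurableT_comp (measurable_powR a)); exact: measurable_ratio.
Qed.

Lemma measurable_escort_score i (x0 : X) t : Theta t ->
  measurable_fun setT (fun x => r t x * s i t x).
Proof.
move=> Tt; apply/measurable_EFinP.
exact: measurable_int (integrable_escort_score i (mixtures_model x0 Tt) Tt).
Qed.

(** The score alone need not be measurable where the weight vanishes, so the
    product is expressed through the measurable weighted scores. *)
Lemma measurable_escort_score2 i j (x0 : X) t : Theta t ->
  measurable_fun setT (fun x => r t x * (s i t x * s j t x)).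
Proof.
move=> Tt.
have -> : (fun x => r t x * (s i t x * s j t x)) =
    (fun x => (r t x * s i t x) * (r t x * s j t x) * (r t x)^-1).
  apply/funext => x; move: (r t x) (s i t x) (s j t x) => rx six sjx.
  have [->|rN] := eqVneq rx 0; first by rewrite !mul0r.
  by field.
apply: measurable_funM; last first.
  by apply: measurable_fun_invr_ge0 (measurable_r Tt) => x; exact: powR_ge0.
by apply: measurable_funM; exact: measurable_escort_score.
Qed.

Lemma Lam_total_mass t : Theta t -> a = 0 -> Lam t = 1.
Proof.
move=> Tt a_eq0; rewrite -(Rintegral_dens Tt).
by apply: eq_Rintegral => x _; rewrite /lam_integrand a_eq0 eqxx.
Qed.

Lemma loglik_criterion Q t : C Q -> Theta t -> a = 0 -> loglik p Q t = - K Q t.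
Proof.
move=> CQ Tt a_eq0; have qi := interchange_int (smooth_Q smooth CQ Tt).
rewrite -[RHS]mulN1r -RintegralZl//; apply: eq_Rintegral => x _.
by rewrite /Q_integrand a_eq0 eqxx mulN1r opprK.
Qed.

Lemma M_criterion Q t : C Q -> Theta t -> a != 0 -> M P p a th Q t = Lam t + K Q t.
Proof.
move=> CQ Tt aN.
have qi := interchange_int (smooth_Q smooth CQ Tt).
have li := interchange_int (smooth_lam smooth Tt).
rewrite /M; case: eqVneq => [a1|a1]; congr (_ + _).
- rewrite Rintegral_model//.
    by apply: eq_Rintegral => x _; rewrite /lam_integrand (negbTE aN) a1 eqxx.
  apply: (measurableT_comp (@measurable_ln R)).
  apply: (measurable_funM (model_dens_meas model Tt)).
  exact: (measurable_fun_invr_ge0 (fun x => model_dens_ge0 model x Th)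
    (model_dens_meas model Th)).
- apply: eq_Rintegral => x _; rewrite /Q_integrand (negbTE aN) a1 invr1 mul1r.
  rewrite powRr1//; apply: divr_ge0.
    exact: (model_dens_ge0 model x Th).
  exact: (model_dens_ge0 model x Tt).
- rewrite (Rintegral_model Tt (measurable_r Tt)).
  have a1N : 1 - a != 0 by rewrite subr_eq0 eq_sym.
  have ri : lam.-integrable setT (EFin \o (fun x => p t x * r t x)).
    have := integrableZl measurableT (1 - a) li.
    apply: eq_integrable => // x _ /=; rewrite /lam_integrand (negbTE aN) (negbTE a1).
    by rewrite -EFinM mulVKf.
  rewrite -RintegralZl//; apply: eq_Rintegral => x _.
  by rewrite /lam_integrand (negbTE aN) (negbTE a1).
- have ri : Q.-integrable setT (EFin \o r t).
    have := integrableZl measurableT a qi.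
    apply: eq_integrable => // x _ /=; rewrite /Q_integrand (negbTE aN).
    by rewrite -EFinM mulVKf.
  rewrite -RintegralZl//; apply: eq_Rintegral => x _.
  by rewrite /Q_integrand (negbTE aN).
Qed.

Hypothesis estimator : subdivergence_estimator P p a th Theta C T.

Lemma estimator_min Q t : C Q -> Theta t ->
  Lam (T Q) + K Q (T Q) <= Lam t + K Q t.
Proof.
move=> CQ Tt; have [TQ /(_ t Tt)] := estimator CQ.
case: eqVneq => [a_eq0|aN]; last by rewrite !M_criterion.
rewrite (loglik_criterion CQ Tt a_eq0) (loglik_criterion CQ TQ a_eq0) lerN2.
rewrite (Lam_total_mass TQ a_eq0) (Lam_total_mass Tt a_eq0).
by move=> KQ; apply: lerD.
Qed.

(** The criterion at the model measure [P t] exceeds its value at [t] by the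
    integral of [p t] times a positive weight times
    [phi a (p (T (P t)) / p t)]; as [phi a] vanishes only at [1], the density
    at the minimizer is that of [P t], and the model is identifiable. *)
Lemma fisher_consistent (x0 : X) t : Theta t -> T (P t) = t.
Proof.
move=> Tt; have CP := mixtures_model x0 Tt; set u := T (P t).
have [Tu _] := estimator CP.
pose h v x := lam_integrand p a th v x + p t x * Q_integrand p a th v x.
have qi v : Theta v -> (P t).-integrable setT (EFin \o Q_integrand p a th v).
  by move=> Tv; exact: interchange_int (smooth_Q smooth CP Tv).
have li v : Theta v -> lam.-integrable setT (EFin \o lam_integrand p a th v).
  by move=> Tv; exact: interchange_int (smooth_lam smooth Tv).
have hi v : Theta v -> lam.-integrable setT (EFin \o h v).
  by move=> Tv; exact: (integrableD measurableT (li _ Tv) (integrable_model Tt (qi _ Tv))).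
have h_int v : Theta v -> \int[lam]_x h v x = Lam v + K (P t) v.
  move=> Tv; rewrite RintegralD//; [congr (_ + _)|exact: li|].
    rewrite /K Rintegral_model//; apply/measurable_EFinP; exact: measurable_int (qi _ Tv).
  exact: integrable_model (qi _ Tv).
have hB : lam.-integrable setT (EFin \o (fun x => h u x - h t x)).
  exact: (integrableB measurableT (hi _ Tu) (hi _ Tt)).
have gap x : 0 < p th x -> 0 < p t x -> 0 < p u x ->
  h u x - h t x = p t x * (r u x * phi a (p u x / p t x)).
  exact: link_subE.
have h0 : {ae lam, forall x, h u x - h t x = 0}.
  apply: ae_eq0_Rintegral_le0 => //.
    apply: filterS2 (density_gt0_ae Tt) (density_gt0_ae Tu) => x [th0 t0] [_ u0].
    rewrite gap// mulr_ge0 ?mulr_ge0 ?phi_ge0 ?powR_ge0 ?divr_gt0//; exact: ltW.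
  rewrite RintegralB//; try exact: hi.
  by rewrite !h_int// subr_le0; exact: estimator_min.
apply: (model_ident model) => // A mA.
rewrite !(model_dens model)//; apply: ae_eq_integral => //.
- apply/measurable_EFinP/measurable_funTS; exact: (model_dens_meas model Tu).
- apply/measurable_EFinP/measurable_funTS; exact: (model_dens_meas model Tt).
have := density_gt0_ae Tu; have := density_gt0_ae Tt; have := h0.
apply: filterS3 => x hx [th0 t0] [_ u0] _ /=.
congr (_%:E); apply/eqP; rewrite -subr_eq0; apply/eqP.
have [|vN] := eqVneq (p u x / p t x) 1.
  by move=> /(canRL (divfK (lt0r_neq0 t0))) ->; rewrite mul1r subrr.
have := phi_gt0 a (divr_gt0 u0 t0) vN.
move: hx; rewrite gap// => /eqP; rewrite !mulf_eq0 (gt_eqF t0) /=.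
rewrite powR_eq0 mulf_eq0 invr_eq0 (gt_eqF th0) (gt_eqF u0) /= => /eqP ->.
by rewrite ltxx.
Qed.

(** The first derivatives of the two integrands satisfy
    [dlam = - p * dQ] near [t], so by the product rule the second derivatives
    of the criterion at its own model measure collapse to
    [- dp * dQ = p * r * s_i * s_j]: no second derivative of the density
    survives. *)
Lemma criterion_hessian i j (x0 : X) t : Theta t ->
  partial j (fun u => partial i Lam u + partial i (K (P t)) u) t =
  \int[P t]_x (r t x * (s i t x * s j t x)).
Proof.
move=> Tt; have CP := mixtures_model x0 Tt.
have sQ := smooth_Q smooth CP Tt; have sL := smooth_lam smooth Tt.
have [_ /(_ i) dL] := interchange_diff sL.
have [_ /(_ i) dK] := interchange_diff sQ.
have dLj : derivable (partial i Lam) t (delta_mx j 0) by exact: diff_derivable.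
have dKj : derivable (partial i (K (P t))) t (delta_mx j 0) by exact: diff_derivable.
rewrite [LHS](deriveD dLj dKj).
pose l2 x := partial j (dlam i x) t; pose q2 x := partial j (dQ i x) t.
transitivity (\int[lam]_x l2 x + \int[P t]_x q2 x).
  by congr (_ + _); [exact: (interchange2 sL i j)|exact: (interchange2 sQ i j)].
have L2 : lam.-integrable setT (EFin \o l2) := interchange_int2 sL i j.
have Q2 : (P t).-integrable setT (EFin \o q2) := interchange_int2 sQ i j.
have mQ2 := (measurable_EFinP _ _).1 (measurable_int _ Q2).
rewrite (Rintegral_model Tt mQ2) -(RintegralD measurableT L2 (integrable_model Tt Q2)).
have mr := measurable_escort_score2 i j x0 Tt.
rewrite (Rintegral_model Tt mr); apply: Rintegral_ae_eq.
- apply: measurable_funD; first exact/measurable_EFinP/(measurable_int _ L2).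
  exact: (measurable_funM (model_dens_meas model Tt)).
- exact: (measurable_funM (model_dens_meas model Tt)).
apply: filterS (density_gt0_ae Tt) => x [th0 t0].
have [/nbhs_singleton dp _] := smooth_dens smooth x Tt.
have [_ /(_ i) ddQ] := Q_integrand_twice_differentiable x Tt.
have dlam_near : \near t, (- (p^~ x * dQ i x)) t = dlam i x t.
  near=> u; have Tu : Theta u by near: u; exact: model_nbhs.
  have u0 : 0 < p u x.
    by near: u; apply: (cvgr_gt (p t x)) => //; exact: differentiable_continuous dp.
  by rewrite !fctE partial_Q_integrand// partial_lam_integrand// mulrN opprK.
have dpj : derivable (p^~ x) t (delta_mx j 0) by exact: diff_derivable.
have ddQj : derivable (dQ i x) t (delta_mx j 0) by exact: diff_derivable.
have lamE : l2 x = - (p t x * q2 x + dQ i x t * partial j (p^~ x) t).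
  transitivity ('D_(delta_mx j 0) (- (p^~ x * dQ i x)) t).
    exact/esym/(near_eq_derive _ dlam_near).
  by rewrite (deriveN (derivableM dpj ddQj)) (deriveM dpj ddQj).
rewrite lamE partial_Q_integrand//.
have -> : partial j (p^~ x) t = p t x * s j t x.
  by rewrite /s /partial derive_ln_comp// mulVKf ?gt_eqF.
by move: (q2 x) (r t x) (s i t x) (s j t x) => *; ring.
Unshelve. all: by end_near. Qed.

(** Linearizes the estimating equation along the contamination at [x]; the
    gradient of the criterion at a contaminated measure is the mixture of the
    gradients at [P t] and at the Dirac measure. *)
Lemma influence_equation (x : X) t : Theta t -> has_IF x T (P t) ->
  escort_info P p a th t *m IF x T (P t) =
  r t x *: score p t x - escort_score_mean P p a th t.
Proof.
move=> Tt hIF; have CP := mixtures_model x Tt.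
pose y e := T (contaminate (P t) x e).
have yw : e^-1 *: (y e - t) @[e --> 0^'+] --> IF x T (P t).
  by rewrite -{1}(fisher_consistent x Tt); exact: hIF.
set w := IF x T (P t) in yw *.
apply/colP => i.
pose A u := partial i Lam u + partial i (K (P t)) u.
pose B u := partial i Lam u + dQ i x u.
have [_ /(_ i) dL] := interchange_diff (smooth_lam smooth Tt).
have [_ /(_ i) dK] := interchange_diff (smooth_Q smooth CP Tt).
have [_ /(_ i) ddQ] := Q_integrand_twice_differentiable x Tt.
have dA : differentiable A t by exact: differentiableD.
have cB : {for t, continuous B}.
  have cL : {for t, continuous (partial i Lam)} by exact: differentiable_continuous.
  have cQ : {for t, continuous (dQ i x)} by exact: differentiable_continuous.
  exact: cvgD cL cQ.
have At : A t = 0 by rewrite /A (partial_Lam i x)// partial_K// subrr.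
have root : \forall e \near 0^'+, (1 - e) * A (y e) + e * B (y e) = 0.
  near=> e.
  have e0 : 0 <= e by [].
  have e1 : e <= 1 by apply: ltW; near: e; exact: nbhs_right_lt.
  have CQ := mixtures_contaminate x Tt e0 e1.
  have [TQ _] := estimator CQ.
  have := estimating_equation i x CQ TQ.
  rewrite -/(y e) in TQ *.
  rewrite partial_K// (Rintegral_contaminate _ e0 e1); last exact: integrable_escort_score.
  rewrite /A /B partial_K// partial_Q_integrand//.
  move: (partial i Lam (y e)) (\int[P t]_x (r (y e) x * s i (y e) x)).
  move: (r (y e) x * s i (y e) x) => b l k E.
  by rewrite -[RHS]E; ring.
have := derive_perturbed_root dA cB At yw root.
rewrite (derive_sum_partial _ dA) => /eqP; rewrite addr_eq0 => /eqP E.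
rewrite !mxE; transitivity (\sum_j w j 0 * partial j A t).
  apply: eq_bigr => j _; rewrite mxE mulrC criterion_hessian//.
  by congr (_ * _); apply: eq_Rintegral => z _; rewrite !mxE.
rewrite E /B (partial_Lam i x)// partial_Q_integrand// opprD opprK [LHS]addrC.
by congr (_ - _); apply: eq_Rintegral => z _; rewrite mxE.
Unshelve. all: by end_near. Qed.

(** The mean of the weighted score is the gradient of [Lam], which is extremal
    here. *)
Lemma escort_score_mean_eq0 (x0 : X) t : Theta t -> a = 0 \/ t = th ->
  escort_score_mean P p a th t = 0.
Proof.
move=> Tt at_th; apply/colP => i; rewrite !mxE.
rewrite -(partial_Lam_eq0 i Tt at_th) (partial_Lam i x0)//.
by apply: eq_Rintegral => z _; rewrite mxE.
Qed.

(** On the points where [p t] vanishes the score vanishes as well, so that the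
    weight may be replaced by [1] everywhere and not only almost everywhere. *)
Lemma escort_weight1 i t x : Theta t -> a = 0 \/ t = th ->
  r t x * score p t x i 0 = score p t x i 0.
Proof.
move=> Tt [a_eq0|t_th]; first by rewrite /r a_eq0 powRr0 mul1r.
have [p0|pN] := eqVneq (p t x) 0.
  by rewrite mxE [partial _ _ _](score_at_zero i Tt p0) mulr0.
by rewrite /r -t_th mulfV// powR1 mul1r.
Qed.

Lemma escort_info_fisher t : Theta t -> a = 0 \/ t = th ->
  escort_info P p a th t = fisher_info P p t.
Proof.
move=> Tt at_th; apply/matrixP => i j; rewrite !mxE.
by apply: eq_Rintegral => x _; rewrite mulrA escort_weight1.
Qed.

Lemma escort_influence_function (x : X) t : Theta t -> has_IF x T (P t) ->
  escort_info P p a th t \in unitmx ->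
  IF x T (P t) = invmx (escort_info P p a th t) *m
    (r t x *: score p t x - escort_score_mean P p a th t).
Proof.
by move=> Tt hIF unitI; rewrite -influence_equation// mulKmx.
Qed.

Lemma fisher_influence_function (x : X) t : Theta t -> has_IF x T (P t) ->
  a = 0 \/ t = th -> fisher_info P p t \in unitmx ->
  IF x T (P t) = invmx (fisher_info P p t) *m score p t x.
Proof.
move=> Tt hIF at_th; rewrite -escort_info_fisher// => unitI.
rewrite escort_influence_function// escort_score_mean_eq0// subr0.
by congr (_ *m _); apply/colP => i; rewrite mxE escort_weight1.
Qed.

End Model.

Theorem theorem2p1p1 (R : realType) (d : nat)
    (disp : measure_display) (X : measurableType disp)
    (lam : {sigma_finite_measure set X -> \bar R})
    (Theta : set 'cV[R]_d) (P : 'cV[R]_d -> probability X R)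
    (p : 'cV[R]_d -> X -> R) (P0 : probability X R)
    (alpha : R) (theta theta0 : 'cV[R]_d)
    (T : probability X R -> 'cV[R]_d)
    (hmodel : standard_model lam Theta P p P0)
    (halpha : 0 <= alpha)
    (htheta : Theta theta) (htheta0 : Theta theta0)
    (hphi : phi_integrable alpha Theta P p P0)
    (hT : subdivergence_estimator P p alpha theta Theta
            (mixtures (calQ Theta P P0)) T)
    (hsmooth : smooth_model P p alpha theta lam Theta
                 (mixtures (calQ Theta P P0)) T)
    (hIF : forall x : X, has_IF x T (P theta0)) :
  [/\ 0 < alpha ->
      escort_info P p alpha theta theta0 \in unitmx ->
      forall x : X, 0 < p theta0 x ->
        IF x T (P theta0) =
        invmx (escort_info P p alpha theta theta0) *m
          ((p theta x / p theta0 x) `^ alpha *: score p theta0 x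
           - escort_score_mean P p alpha theta theta0),
      alpha = 0 ->
      fisher_info P p theta0 \in unitmx ->
      forall x : X, 0 < p theta0 x ->
        IF x T (P theta0) = invmx (fisher_info P p theta0) *m score p theta0 x
    & theta = theta0 ->
      fisher_info P p theta0 \in unitmx ->
      forall x : X, 0 < p theta0 x ->
        IF x T (P theta0) = invmx (fisher_info P p theta0) *m score p theta0 x].
Proof.
split=> [_ unitI x _|a_eq0 unitI x _|th_eq unitI x _].
- exact: (escort_influence_function hmodel halpha htheta hsmooth hT htheta0 (hIF x)).
- apply: (fisher_influence_function hmodel halpha htheta hsmooth hT htheta0 (hIF x)) => //.
  by left.
- apply: (fisher_influence_function hmodel halpha htheta hsmooth hT htheta0 (hIF x)) => //.
  by right.
Qed.
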